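(* Let $\mathbb{O}$ be an octonion algebra over a field $k$ of characteristic not two or three, and let $\mathfrak{h}=C^2(\mathrm{Im}(\mathbb{O}),-q)$ with $B_{\mathfrak{h}}(x,y)=-\frac{3}{8}\mathrm{Tr}(\rho(x)\rho(y))$. The ($8$-dimensional spinor) representation $\rho : \mathfrak{h} \rightarrow \mathfrak{so}(\mathbb{O},B)$ of the quadratic Lie algebra $(\mathfrak{h},B_{\mathfrak{h}})$ is a special orthogonal representation.
   Context: For an orthogonal representation $\rho:\mathfrak{h}\to\mathfrak{so}(V,(\ ,\ ))$ of a finite-dimensional quadratic Lie algebra $(\mathfrak{h},B_{\mathfrak{h}})$ (a Lie algebra with a non-degenerate ad-invariant symmetric bilinear form), the moment map is the alternating bilinear map $\mu:V\times V\to\mathfrak{h}$ determined by $B_{\mathfrak{h}}(x,\mu(v,w))=(\rho(x)(v),w)$ for all $x\in\mathfrak{h}$, $v,w\in V$. Write $\mu(u,v)(w)$ for $\rho(\mu(u,v))(w)$. The representation is called special orthogonal if $$\mu(u,v)(w)+\mu(u,w)(v)=(u,v)w+(u,w)v-2(v,w)u\qquad\forall u,v,w\in V.$$ $\mathbb{O}$ is an octonion (Cayley) algebra over $k$, i.e. an $8$-dimensional unital composition algebra, with norm $q$ and conjugation $u\mapsto\bar u$, $q(u)=u\bar u$; $\mathrm{Im}(\mathbb{O})=\{u\in\mathbb{O}: \bar u=-u\}$; $B$ is the symmetric bilinear form with $B(u,u)=q(u)$. Left multiplication $\rho(u)(x)=ux$ ($u\in\mathrm{Im}(\mathbb{O})$,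 $x\in\mathbb{O}$) satisfies $\rho(u)^2=-q(u)\mathrm{Id}$, hence extends to an algebra morphism $\rho:C(\mathrm{Im}(\mathbb{O}),-q)\to\mathrm{End}(\mathbb{O})$ from the Clifford algebra (in which $u^2=-q(u)$). $C^2(\mathrm{Im}(\mathbb{O}),-q)$ is the span of the elements $uv-vu$ with $u,v\in\mathrm{Im}(\mathbb{O})$, a Lie algebra under the commutator, isomorphic to $\mathfrak{so}(\mathrm{Im}(\mathbb{O}),q)$. *)

(* Defs.v *)
From HB Require Import structures.
From mathcomp Require Import all_boot all_algebra.
From mathcomp Require Import falgebra ring.

Set Implicit Arguments.
Unset Strict Implicit.
Unset Printing Implicit Defensive.

Import GRing.Theory.
Local Open Scope ring_scope.

HB.mixin Record Vector_isLie (k : fieldType) g of Vector k g := {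
  lie : g -> g -> g;
  lie_linearl : forall y, linear (lie ^~ y);
  lie_linearr : forall x, linear (lie x);
  liexx : forall x, lie x x = 0;
  lie_jacobi :
    forall x y z, lie x (lie y z) + lie y (lie z x) + lie z (lie x y) = 0
}.

#[short(type="lieType")]
HB.structure Definition Lie (k : fieldType) := {g of Vector k g & Vector_isLie k g}.

Section SpecialOrthogonal.
Variables (k : fieldType) (h : lieType k) (V : vectType k).
Variables (Bh : {symmetric h}) (f : {symmetric V}).
Variable rho : {linear h -> 'End(V)}.

Definition quadratic_lie : Prop :=
  nondegenerate Bh /\
  (forall x y z : h, Bh (lie x y) z = Bh x (lie y z)).

Definition orthogonal_rep : Prop :=
  [/\ nondegenerate f,
      (forall x y : h, rho (lie x y) = (rho x \o rho y)%VF - (rho y \o rho x)%VF)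
    & (forall (x : h) (v w : V), f (rho x v) w = - f v (rho x w))].

(* As Bh is nondegenerate, at most one mu satisfies the last equation. *)
Definition moment_map (mu : {bilinear V -> V -> h}) : Prop :=
  (forall v, mu v v = 0) /\
  (forall x v w, Bh x (mu v w) = f (rho x v) w).

Definition special_orthogonal : Prop :=
  [/\ quadratic_lie, orthogonal_rep
    & exists2 mu : {bilinear V -> V -> h}, moment_map mu &
        forall u v w : V,
          rho (mu u v) w + rho (mu u w) v =
          f u v *: w + f u w *: v - (2%:R * f v w) *: u].

End SpecialOrthogonal.

Section EndAlgebra.
Variables (k : fieldType) (V : vectType k).

Definition lftrace (f : 'End(V)) : k :=
  \tr (passmx.mxof (vbasis {:V}) (vbasis {:V}) f).

Lemma lftrace_is_linear : scalar lftrace.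
Proof. by move=> a f g; rewrite /lftrace passmx.mxof_linear mxtraceD mxtraceZ. Qed.

Lemma lftraceC (f g : 'End(V)) : lftrace (f \o g)%VF = lftrace (g \o f)%VF.
Proof. by rewrite /lftrace !(passmx.mxof_comp _ _ (vbasisP _)) mxtrace_mulC. Qed.

Hypothesis V_gt0 : (0 < \dim {:V})%N.

Let V_proper : (0 < dim V)%N. Proof. by rewrite -dimvf. Qed.

(* MathComp's lfun_algType multiplies in the reverse order of composition; here
   f * g is f \o g. *)
Definition end_lalgType : lalgType k :=
  HB.pack 'End(V) (lfun_comp_nzRingType V_proper)
    (GRing.Lmodule_isLalgebra.Build k (lfun_comp_nzRingType V_proper)
       (fun a (f g : 'End(V)) => comp_lfunZl a f g)).

Definition end_algType : algType k :=
  HB.pack 'End(V) end_lalgType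
    (GRing.Lalgebra_isAlgebra.Build k end_lalgType
       (fun a (f g : 'End(V)) => comp_lfunZr a f g)).

End EndAlgebra.

Definition polar (k : fieldType) (V : lmodType k) (q : V -> k) (u v : V) : k :=
  q (u + v) - q u - q v.

Definition quadratic_form (k : fieldType) (V : lmodType k) (q : V -> k) : Prop :=
  (forall a u, q (a *: u) = a ^+ 2 * q u) /\ (forall v, scalar (polar q ^~ v)).

HB.mixin Record Vector_isComposition (k : fieldType) O of Vector k O := {
  omul : O -> O -> O;
  oone : O;
  onorm : O -> k;
  omul_linearl : forall y, linear (omul ^~ y);
  omul_linearr : forall x, linear (omul x);
  omul1x : left_id oone omul;
  omulx1 : right_id oone omul;
  oone_neq0 : oone != 0;
  onorm_quadratic : quadratic_form onorm;
  onorm_nondeg : forall u, (forall v, polar onorm u v = 0) -> u = 0;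
  onormM : forall x y, onorm (omul x y) = onorm x * onorm y
}.

#[short(type="compositionType")]
HB.structure Definition Composition (k : fieldType) :=
  {O of Vector k O & Vector_isComposition k O}.

HB.mixin Record Composition_isOctonion (k : fieldType) O of Composition k O := {
  oct_dim : \dim {:O} = 8
}.

#[short(type="octonionType")]
HB.structure Definition Octonion (k : fieldType) :=
  {O of Composition k O & Composition_isOctonion k O}.

Section CompositionTheory.
Variables (k : fieldType) (O : compositionType k).
Implicit Types (a : k) (u v x y : O).

HB.instance Definition _ u :=
  GRing.isSemilinear.Build k O O _ (omul u)
    (GRing.semilinear_linear (omul_linearr u)).

Lemma opolarC u v : polar (@onorm k O) u v = polar (@onorm k O) v u.
Proof. by rewrite /polar [v + u]addrC addrAC. Qed.

Lemma opolarPl a u v w : polar (@onorm k O) (a *: u + v) w =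
  a * polar (@onorm k O) u w + polar (@onorm k O) v w.
Proof. exact: (@onorm_quadratic k O).2. Qed.

Lemma opolarPr a u v w : polar (@onorm k O) w (a *: u + v) =
  a * polar (@onorm k O) w u + polar (@onorm k O) w v.
Proof. by rewrite opolarC opolarPl !(opolarC w). Qed.

Lemma composition_gt0 : (0 < \dim {:O})%N.
Proof.
rewrite lt0n dimv_eq0; apply: contraNneq (oone_neq0 (s := O)) => O0.
by rewrite -memv0 -O0 memvf.
Qed.

Definition omulr x u := omul u x.
Definition opolarr v u := polar (@onorm k O) u v.

(* The form B with B u u = q u, see oformxx; junk in characteristic two. *)
Definition oform u v : k := polar (@onorm k O) u v / 2%:R.

Lemma oform_bilinear : bilinear_for
  (GRing.Scale.Law.clone _ _ *%R _) (GRing.Scale.Law.clone _ _ (idfun \; *%R) _)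
  oform.
Proof.
split=> [w|w] a u v; rewrite /oform /= ?opolarPl ?opolarPr mulrDl mulrA //.
Qed.
HB.instance Definition _ :=
  bilinear_isBilinear.Build k O O k _ _ oform oform_bilinear.

Lemma oform_sym u v : oform u v = (-1) ^+ false * idfun (oform v u).
Proof. by rewrite mul1r /oform opolarC. Qed.
HB.instance Definition _ :=
  isHermitianSesquilinear.Build k O false idfun oform oform_sym.

Lemma oformxx : 2%N \notin [pchar k] -> forall u, oform u u = onorm u.
Proof.
rewrite inE /= => k2 u; have [nZ _] := @onorm_quadratic k O.
have -> : oform u u = (onorm u + onorm u) / 2%:R.
  rewrite /oform /polar -mulr2n -scaler_nat nZ; congr (_ / _).
  rewrite expr2 -natrM -[(2 * 2)%N]/4%N mulr_natl.
  by rewrite !mulrSr mulr0n add0r !addrK.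
by rewrite -mulr2n -[X in X / _]mulr_natr mulfK.
Qed.

(* By omul_oconj, u * oconj u = q u. *)
Definition oconj u : O := polar (@onorm k O) u oone *: oone - u.

Lemma oconj_is_linear : linear oconj.
Proof.
by move=> a u v; rewrite /oconj opolarPl scalerDl scalerBr scalerA opprD addrACA.
Qed.
HB.instance Definition _ :=
  GRing.isSemilinear.Build k O O _ oconj (GRing.semilinear_linear oconj_is_linear).


Lemma opolarMl w y z : polar (@onorm k O) (omul w y) (omul w z) =
  onorm w * polar (@onorm k O) y z.
Proof. by rewrite /polar -linearD !onormM -!mulrBr. Qed.

HB.instance Definition _ x :=
  GRing.isSemilinear.Build k O O _ (omulr x)
    (GRing.semilinear_linear (omul_linearl x)).

HB.instance Definition _ v :=
  GRing.isSemilinear.Build k O k *%R (opolarr v)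
    (GRing.semilinear_linear ((@onorm_quadratic k O).2 v)).

Lemma omul_oconjl u x :
  omul (oconj u) x = polar (@onorm k O) u oone *: x - omul u x.
Proof. by rewrite -[LHS]/(omulr x _) linearB linearZ /= /omulr omul1x. Qed.

Lemma opolar_oconj u x y :
  polar (@onorm k O) (omul (oconj u) x) y = polar (@onorm k O) x (omul u y).
Proof.
have RD v w z : omul (v + w) z = omul v z + omul w z := linearD (omulr z) v w.
have PDl v w z : polar (@onorm k O) (v + w) z =
  polar (@onorm k O) v z + polar (@onorm k O) w z := linearD (opolarr z) v w.
have PDr v w z : polar (@onorm k O) z (v + w) =
  polar (@onorm k O) z v + polar (@onorm k O) z w by rewrite !(opolarC z) PDl.
rewrite omul_oconjl.
have -> : polar (@onorm k O) (polar (@onorm k O) u oone *: x - omul u x) y =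
    polar (@onorm k O) u oone * polar (@onorm k O) x y
    - polar (@onorm k O) (omul u x) y.
  by rewrite -[LHS]/(opolarr y _) linearB linearZ.
have := opolarMl (u + oone) x y.
rewrite !RD !omul1x PDl !PDr !opolarMl.
have -> : onorm (u + oone) = polar (@onorm k O) u oone + onorm u + onorm (oone : O).
  by rewrite /polar; ring.
have := opolarMl oone x y; rewrite !omul1x.
move: (polar _ u oone) (polar _ x y) (polar _ (omul u x) y) (polar _ x (omul u y)).
move: (onorm u) (onorm (oone : O)) => n e p c s t ec E.
have -> : p * c = (p + n + e) * c - n * c - e * c by ring.
by rewrite -E -ec; ring.
Qed.

Lemma oconj_mulK u x : omul (oconj u) (omul u x) = onorm u *: x.
Proof.
apply/eqP; rewrite -subr_eq0; apply/eqP/onorm_nondeg => y.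
rewrite addrC -scaleN1r scalerA opolarPl opolar_oconj opolarMl; ring.
Qed.

Lemma omul_oconj u : omul u (oconj u) = onorm u *: oone.
Proof.
have := oconj_mulK u oone; rewrite omulx1 omul_oconjl => <-.
by rewrite linearB linearZ /= omulx1.
Qed.

Definition oim : {vspace O} := lker (linfun oconj + \1)%VF.

Lemma mem_oim u : (u \in oim) = (oconj u == - u).
Proof. by rewrite memv_ker add_lfunE id_lfunE lfunE addr_eq0. Qed.

Definition oim_mull (u : subvs_of oim) : 'End(O) := linfun (omul (vsval u)).

Lemma oim_mull_is_linear : linear oim_mull.
Proof.
move=> a u v; apply/lfunP => x.
by rewrite !(add_lfunE, scale_lfunE, lfunE) /= -[LHS]/(omulr x _) !linearP.
Qed.
HB.instance Definition _ :=
  GRing.isSemilinear.Build k (subvs_of oim) 'End(O) _ oim_mull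
    (GRing.semilinear_linear oim_mull_is_linear).

Lemma oim_mull_sqr (u : subvs_of oim) :
  (oim_mull u \o oim_mull u)%VF = - onorm (vsval u) *: \1%VF.
Proof.
apply/lfunP => x; rewrite comp_lfunE scale_lfunE id_lfunE !lfunE /= scaleNr.
have /eqP uN : oconj (vsval u) == - vsval u by rewrite -mem_oim subvsP.
by rewrite -oconj_mulK uN -[in RHS]/(omulr _ _) linearN /= opprK.
Qed.

End CompositionTheory.

(* The Clifford algebra of (V, Q), with v ^ 2 = Q v, is given by its universal
   property. As V is finite-dimensional so is its Clifford algebra, hence the
   carrier can be taken in falgType without loss of generality. *)
Record cliffordAlgebra (k : fieldType) (V : vectType k) (Q : V -> k) :=
  CliffordAlgebra {
    clifford_sort :> falgType k;
    clifford_in : {linear V -> clifford_sort};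
    clifford_sqr : forall v, clifford_in v * clifford_in v = (Q v)%:A;
    clifford_lift : forall (A : algType k) (f : {linear V -> A}),
      (forall v, f v * f v = (Q v)%:A) -> {lrmorphism clifford_sort -> A};
    clifford_lift_in : forall (A : algType k) (f : {linear V -> A})
      (Hf : forall v, f v * f v = (Q v)%:A) v,
      clifford_lift Hf (clifford_in v) = f v;
    clifford_ext : forall (A : algType k) (f g : {lrmorphism clifford_sort -> A}),
      (forall v, f (clifford_in v) = g (clifford_in v)) -> f =1 g
  }.

Section CliffordC2.
Variables (k : fieldType) (V : vectType k) (Q : V -> k) (C : cliffordAlgebra Q).
Implicit Types (u v w : V) (x y z : C).
Local Notation i := (clifford_in C).

Definition commr x y : C := x * y - y * x.

(* By clifford2_sub, this is the span of the commutators of all u, v in V. *)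
Definition clifford2 : {vspace C} :=
  <<[seq commr (i u) (i v) | u <- vbasis {:V}, v <- vbasis {:V}]>>%VS.

Definition commrr y x := commr x y.

Lemma commr_linear x : linear (commr x).
Proof.
move=> a y z; rewrite /commr mulrDr mulrDl -scalerAr -scalerAl scalerBr.
by rewrite opprD addrACA.
Qed.
HB.instance Definition _ x :=
  GRing.isSemilinear.Build k C C _ (commr x) (GRing.semilinear_linear (commr_linear x)).

Lemma commrN x y : commr x y = - commr y x.
Proof. by rewrite /commr opprB. Qed.

Lemma commrr_linear y : linear (commrr y).
Proof. by move=> a x z; rewrite /commrr !(commrN _ y) linearP opprD scalerN. Qed.
HB.instance Definition _ y :=
  GRing.isSemilinear.Build k C C _ (commrr y) (GRing.semilinear_linear (commrr_linear y)).

Lemma clifford2_sub (W : {vspace C}) :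
  (clifford2 <= W)%VS <-> (forall u v, commr (i u) (i v) \in W).
Proof.
split=> [/subvP sW u v | sW]; last first.
  by apply/span_subvP => _ /allpairsP[[u v] [_ _ ->]]; apply: sW.
rewrite (coord_vbasis (memvf u)) (coord_vbasis (memvf v)) !linear_sum.
apply: rpred_sum => b _; rewrite -[X in X \in _]/(commrr _ _) linear_sum.
apply: rpred_sum => a _; rewrite ![clifford_in C (_ *: _)]linearZ /= linearZ /=.
apply: memvZ; rewrite /commrr linearZ; apply: memvZ.
by apply/sW/memv_span/allpairs_f; apply: memt_nth.
Qed.

Lemma clifford2_in u v : commr (i u) (i v) \in clifford2.
Proof. by move: u v; apply/clifford2_sub. Qed.

Lemma clifford_anti u v : i v * i u = (polar Q u v)%:A - i u * i v.
Proof.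
rewrite /polar !scalerBl -!clifford_sqr linearD mulrDl !mulrDr.
set a := i u * i u; set b := i u * i v; set c := i v * i u; set d := i v * i v.
by rewrite addrA [_ - a - d]addrAC addrK -addrA -opprD addrAC subrr add0r.
Qed.

Lemma commr3 u v w : commr (commr (i u) (i v)) (i w) =
  i ((polar Q v w *+ 2) *: u - (polar Q u w *+ 2) *: v).
Proof.
rewrite linearB !linearZ /= /commr mulrBl mulrBr !mulrA.
rewrite (clifford_anti u w) (clifford_anti v w) !mulrBl -!mulrA.
rewrite (clifford_anti u w) (clifford_anti v w) !mulrBr !mulr_algl !mulr_algr.
rewrite scalerN -!scalerMnl -mulNrn -mulrnDl.
set b := i u * (_ * _); set c := i v * (_ * _); set p := _ *: i v; set q := _ *: i u.
rewrite [LHS](_ : _ = (b - c) + ((q - p) + (- (b - c) + (q - p)))).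
  by rewrite addrCA addNKr mulr2n.
by rewrite !opprB [c - p]addrC [q - b]addrC -!addrA.
Qed.

Lemma commrJ x y z : commr x (commr y z) = commr (commr x y) z + commr y (commr x z).
Proof.
rewrite /commr !mulrBl !mulrBr !mulrA.
set a := x * y * z; set b := x * z * y; set c := y * z * x; set d := z * y * x.
set e := y * x * z; set f := z * x * y.
rewrite [RHS]addrACA -opprD [a - e + _]addrA subrK [f - d + _]addrC addrA subrK.
by rewrite !opprB addrACA [- b + _]addrC -addrACA [d - b]addrC.
Qed.

Lemma clifford2_closed x y :
  x \in clifford2 -> y \in clifford2 -> commr x y \in clifford2.
Proof.
suff sub u v : (clifford2 <= linfun (commr (commr (i u) (i v))) @^-1: clifford2)%VS.
  move=> xC yC; suff /subvP/(_ x xC) :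
      (clifford2 <= linfun (commrr y) @^-1: clifford2)%VS.
    by rewrite -memv_preim lfunE.
  apply/clifford2_sub => u v; rewrite -memv_preim lfunE /=.
  by have /subvP/(_ y yC) := sub u v; rewrite -memv_preim lfunE.
apply/clifford2_sub => w z; rewrite -memv_preim lfunE /= commrJ !commr3.
by apply: memvD; apply: clifford2_in.
Qed.

Definition clifford2_type := subvs_of clifford2.
HB.instance Definition _ := Vector.on clifford2_type.
Implicit Types a b c : clifford2_type.

(* vsproj does not alter the commutator, see val_clifford2_lie. *)
Definition clifford2_lie a b : clifford2_type :=
  vsproj clifford2 (commr (vsval a) (vsval b)).

Lemma val_clifford2_lie a b :
  vsval (clifford2_lie a b) = commr (vsval a) (vsval b).
Proof. by rewrite vsprojK // clifford2_closed ?subvsP. Qed.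

Lemma clifford2_lie_linearl b : linear (clifford2_lie ^~ b).
Proof.
move=> t a c; apply: (can_inj (@vsvalK _ _ _)); rewrite linearP /= !val_clifford2_lie linearP.
by rewrite -[LHS]/(commrr _ _) linearP.
Qed.

Lemma clifford2_lie_linearr a : linear (clifford2_lie a).
Proof.
by move=> t b c; apply: (can_inj (@vsvalK _ _ _)); rewrite linearP /= !val_clifford2_lie !linearP.
Qed.

Lemma clifford2_liexx a : clifford2_lie a a = 0.
Proof. by apply: (can_inj (@vsvalK _ _ _)); rewrite val_clifford2_lie /commr subrr linear0. Qed.

Lemma clifford2_lie_jacobi a b c :
  clifford2_lie a (clifford2_lie b c) + clifford2_lie b (clifford2_lie c a)
  + clifford2_lie c (clifford2_lie a b) = 0.
Proof.
apply: (can_inj (@vsvalK _ _ _)); rewrite !linearD linear0 /= !val_clifford2_lie.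
rewrite [X in X + _ + _]commrJ [commr (vsval c) (vsval a)]commrN linearN.
by rewrite [X in _ + X]commrN /= addrK subrr.
Qed.

HB.instance Definition _ :=
  Vector_isLie.Build k clifford2_type clifford2_lie_linearl
    clifford2_lie_linearr clifford2_liexx clifford2_lie_jacobi.

End CliffordC2.

Definition oim_quad (k : fieldType) (O : compositionType k)
  (u : subvs_of (oim O)) : k := - onorm (vsval u).
Arguments oim_quad {k} O u.

Section Spinor.
Variables (k : fieldType) (O : compositionType k).
Variable C : cliffordAlgebra (oim_quad O).

Definition clifford_rep : {lrmorphism C -> end_algType (composition_gt0 O)} :=
  @clifford_lift k _ _ C (end_algType (composition_gt0 O)) (@oim_mull k O)
    (@oim_mull_sqr k O).

Definition spinor_rep (x : clifford2_type C) : 'End(O) := clifford_rep (vsval x).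

Lemma spinor_rep_is_linear : linear spinor_rep.
Proof. by move=> a x y; rewrite /spinor_rep !linearP. Qed.
HB.instance Definition _ :=
  GRing.isSemilinear.Build k (clifford2_type C) 'End(O) _ spinor_rep
    (GRing.semilinear_linear spinor_rep_is_linear).

Definition spinor_form (x y : clifford2_type C) : k :=
  - (3%:R / 8%:R) * lftrace (spinor_rep x \o spinor_rep y)%VF.

Lemma spinor_form_bilinear : bilinear_for
  (GRing.Scale.Law.clone _ _ *%R _) (GRing.Scale.Law.clone _ _ (idfun \; *%R) _)
  spinor_form.
Proof.
split=> [y|x] a u v; rewrite /spinor_form linearP /=.
  by rewrite comp_lfunDl -comp_lfunZl lftrace_is_linear; ring.
by rewrite comp_lfunDr -comp_lfunZr lftrace_is_linear; ring.
Qed.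
HB.instance Definition _ :=
  bilinear_isBilinear.Build k (clifford2_type C) (clifford2_type C) k _ _
    spinor_form spinor_form_bilinear.

Lemma spinor_form_sym x y :
  spinor_form x y = (-1) ^+ false * idfun (spinor_form y x).
Proof. by rewrite mul1r /spinor_form lftraceC. Qed.
HB.instance Definition _ :=
  isHermitianSesquilinear.Build k (clifford2_type C) false idfun spinor_form
    spinor_form_sym.

End Spinor.

(* Main.v *)
Require Import Defs.
From HB Require Import structures.
From mathcomp Require Import all_boot all_algebra falgebra.
From mathcomp Require Import ring.

(** Write P for the polar form of the norm, so P = 2 B, write v^ for the
    conjugate of v and L_u for left multiplication by u, and let S be the image
    of the Lie algebra h in End(O); S is spanned by the commutators [L_a, L_b]
    with a, b imaginary.

    The whole statement rests on knowing the moment map. Since so(O) is the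
    direct sum of S and of the L_c with c imaginary, orthogonally for the trace
    form, rho (mu (v, w)) has to be a multiple of the projection to S of the
    infinitesimal rotation z |-> P v z w - P w z v. This gives the candidate
      6 rho (mu (v, w)) z
        = 4 (P v z w - P w z v) - 2 (w v^) z + P v w z =: spin_op v w z,
    where the last two terms are -2 L_c for c the imaginary part of w v^. Given
    this formula, special orthogonality is the linearization of the Moufang
    identity (v u^) v = P u v v - q(v) u (moufang_polar).

    It remains to see that spin_op v w does lie in S, with no dimension count.
    - For imaginary w take bases e, e' of Im O, dual for P, and form
      D = \sum_i [L_(e_i), L_([w, e'_i])], an element of S. The Clifford
      relations give [D, L_a] = 4 L_([w, a]) and D 1 = 12 w; the coefficient 12
      is 2 * 7 - 2, and this is where dim O = 8 matters. A linear map on O is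
      determined by its value at 1 and its commutators with the L_a, so
      D = 2 spin_op 1 w (spin_sumE).
    - The rotations in the planes spanned by 1 and an imaginary vector generate
      so(O): the commutator of spin_op 1 v and spin_op 1 w is
      4 spin_op v w up to elements already known to be in S (spin_op_oim).

    The moment equation then amounts to tr (g L_c) = 0 for g in S and c
    imaginary (lftrace_lmul3); it is read off from L_c = 2 r - N with r the
    rotation for the pair (1, c) and N = spin_op 1 c / 2 in S. Non-degeneracy of
    the trace form on h comes from tr (rho x [L_u, L_v]) = tr ([rho x, L_u] L_v),
    which forces x in the radical to commute with Im O in the Clifford algebra,
    and from 2 x = \sum_i e_i [x, e'_i] there (sum_clifford_in). *)

Set Implicit Arguments.
Unset Strict Implicit.
Unset Printing Implicit Defensive.

Import GRing.Theory.
Local Open Scope ring_scope.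

(** * Traces, commutators and dual bases *)

(** Reduces an equation that follows from another one by linear combination to a
    ring identity. *)
Lemma eq_of_eqB (V : zmodType) (x y a b : V) : a = b -> x - y = a - b -> x = y.
Proof. by move=> ->; rewrite subrr => /eqP; rewrite subr_eq0 => /eqP. Qed.

Lemma linear_sumZ (k : fieldType) (V W : lmodType k) (f : V -> W) :
  linear f -> forall n (c : 'I_n -> k) (x : 'I_n -> V),
  f (\sum_i c i *: x i) = \sum_i c i *: f (x i).
Proof.
move=> fl n c x.
pose fL : {linear V -> W} := HB.pack f
  (GRing.isSemilinear.Build k _ _ _ f (GRing.semilinear_linear fl)).
rewrite -[LHS]/(fL _) linear_sum; apply: eq_bigr => i _.
by rewrite linearZ.
Qed.

Section LinearAlgebra.
Variables (k : fieldType) (V : vectType k).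

HB.instance Definition _ :=
  GRing.isSemilinear.Build k 'End(V) k *%R (@lftrace k V)
    (GRing.semilinear_linear (@lftrace_is_linear k V)).

Lemma lftrace1 : lftrace (\1%VF : 'End(V)) = (\dim {:V})%:R.
Proof. by rewrite /lftrace passmx.mxof1 ?mxtrace1 // (basis_free (vbasisP _)). Qed.

Lemma lftrace_sum (f : 'End(V)) :
  lftrace f = \sum_i coord (vbasis {:V}) i (f (vbasis {:V})`_i).
Proof.
apply: eq_bigr => i _; rewrite !mxE /=.
by rewrite passmx.vecof_delta.
Qed.

Lemma lftrace_rank2 (g g' : {scalar V}) (w w' : V) (f : 'End(V)) :
  (forall z, f z = g z *: w + g' z *: w') -> lftrace f = g w + g' w'.
Proof.
move=> fE; rewrite lftrace_sum.
rewrite [in g w](coord_vbasis (memvf w)) [in g' w'](coord_vbasis (memvf w')).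
rewrite !linear_sum -big_split; apply: eq_bigr => i _.
by rewrite fE linearD !linearZ /= mulrC [in RHS]addrC [g' _ * _]mulrC [in RHS]addrC.
Qed.

Definition lfbracket (f g : 'End(V)) : 'End(V) := (f \o g)%VF - (g \o f)%VF.

Lemma lfbracketE f g z : lfbracket f g z = f (g z) - g (f z).
Proof. by rewrite /lfbracket add_lfunE opp_lfunE !comp_lfunE. Qed.

Lemma lftrace_bracket f g h :
  lftrace (lfbracket f g \o h)%VF = lftrace (f \o lfbracket g h)%VF.
Proof.
rewrite /lfbracket comp_lfunDl comp_lfunDr comp_lfunNl comp_lfunNr !linearB /=.
by rewrite -!comp_lfunA [X in _ - X]lftraceC -comp_lfunA.
Qed.

Section DualBases.
Variable b : V -> V -> k.
Hypotheses (bl : forall y, scalar (b ^~ y)) (bC : forall x y, b x y = b y x).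
Hypothesis b0 : forall x, (forall y, b x y = 0) -> x = 0.

Lemma dual_bases : exists e e' : 'I_(\dim {:V}) -> V,
  [/\ forall i, b (e i) (e' i) = 1, forall u, \sum_i b u (e' i) *: e i = u
    & forall u, \sum_i b u (e i) *: e' i = u].
Proof.
have br x : scalar (b x) by move=> a u v; rewrite !(bC x) bl.
pose e (i : 'I_(\dim {:V})) := (vbasis {:V})`_i.
(* The vector e' j solves b (e i) (e' j) = delta for all i; such a vector exists
   because the Gram map of a nondegenerate form is injective, hence onto. *)
pose gram v : 'rV[k]_(\dim {:V}) := \row_i b (e i) v.
have gram_lin : linear gram.
  by move=> a u v; apply/rowP => i; rewrite !mxE br.
pose gramL : {linear V -> 'rV_(\dim {:V})} := HB.pack gram
  (GRing.isSemilinear.Build k _ _ _ gram (GRing.semilinear_linear gram_lin)).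
have sumb n (c : 'I_n -> k) (x : 'I_n -> V) y :
    b (\sum_i c i *: x i) y = \sum_i c i * b (x i) y.
  exact: (linear_sumZ (W := k^o) (bl y)).
pose G := linfun gramL.
have G0 : lker G = 0%VS.
  apply/eqP/lker0P => u v; rewrite !lfunE /= => /rowP uv.
  apply/eqP; rewrite -subr_eq0; apply/eqP/b0 => y.
  rewrite bC (coord_vbasis (memvf y)) sumb big1 // => i _.
  have := uv i; rewrite !mxE => E.
  by rewrite addrC -scaleN1r br mulN1r -/(e i) E addNr mulr0.
have GT : limg G = fullv.
  apply/eqP; rewrite eqEdim subvf.
  have := limg_ker_dim G fullv; rewrite G0 capv0 dimv0 add0n => ->.
  by rewrite dimvf /dim /= mul1n.
pose e' j := (G^-1)%VF (delta_mx 0 j).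
have ee' i j : b (e i) (e' j) = (i == j)%:R.
  have : G (e' j) = delta_mx 0 j by rewrite limg_lfunVK // GT memvf.
  by rewrite lfunE => /rowP/(_ i); rewrite !mxE eqxx.
have sum1 u : \sum_i b u (e' i) *: e i = u.
  rewrite {2}(coord_vbasis (memvf u)); apply: eq_bigr => i _; congr (_ *: _).
  rewrite {1}(coord_vbasis (memvf u)) sumb (bigD1 i) //= -/(e i) ee' eqxx mulr1.
  by rewrite big1 ?addr0 // => j /negPf ji; rewrite -/(e j) ee' ji mulr0.
exists e, e'; split=> // [i|u]; first by rewrite ee' eqxx.
apply/eqP; rewrite -subr_eq0; apply/eqP/b0 => y.
rewrite addrC -scaleN1r bl mulN1r sumb -[in - b u y](sum1 y) [b u _]bC sumb.
rewrite addrC; apply/eqP; rewrite subr_eq0; apply/eqP; apply: eq_bigr => i _.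
by rewrite mulrC [b (e' i) y]bC [b u _]bC.
Qed.

End DualBases.
End LinearAlgebra.

(** The tensor \sum_i e_i (x) e'_i is the inverse of the form b, hence symmetric
    like b. *)
Lemma dual_sumC (k : fieldType) (V W : lmodType k) (b : V -> V -> k) n
    (e e' : 'I_n -> V) (F : V -> V -> W) :
  (forall x y, b x y = b y x) -> (forall u, \sum_i b u (e i) *: e' i = u) ->
  (forall y, linear (F ^~ y)) -> (forall x, linear (F x)) ->
  \sum_i F (e i) (e' i) = \sum_i F (e' i) (e i).
Proof.
move=> bC eE Fl Fr.
under eq_bigr => i _ do rewrite -{1}(eE (e i)) (linear_sumZ (Fl _)).
rewrite exchange_big; apply: eq_bigr => j _.
rewrite -{2}(eE (e j)) (linear_sumZ (Fr _)).
by apply: eq_bigr => i _; rewrite bC.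
Qed.

Lemma clifford2_ind (k : fieldType) (V : vectType k) (Q : V -> k)
    (C : cliffordAlgebra Q) (T : clifford2_type C -> Prop) :
  (forall a x y, T x -> T y -> T (a *: x + y)) -> T 0 ->
  (forall u v, T (vsproj (clifford2 C) (commr (clifford_in C u) (clifford_in C v)))) ->
  forall x, T x.
Proof.
move=> TP T0 Tc x; rewrite -[x]vsvalK.
pose i := clifford_in C.
pose X := [seq commr (i u) (i v) | u <- vbasis {:V}, v <- vbasis {:V}].
have /(@coord_span _ _ _ (in_tuple X)) -> : vsval x \in <<X>>%VS by apply: subvsP.
rewrite linear_sum; elim/big_rec: _ => // j y _ Ty.
rewrite linearZ; apply: TP => //.
have /allpairsP[[u v] [_ _ /= ->]] : (in_tuple X)`_j \in X by rewrite mem_nth.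
exact: Tc.
Qed.

(** * Identities in composition algebras *)

Section CompositionAlgebra.
Variables (k : fieldType) (O : compositionType k).
Implicit Types (a b c u v w x y z : O) (s t : k).

Local Notation P := (polar (@onorm k O)).
Local Notation "x ** y" := (omul x y) (at level 40, left associativity).
Local Notation "1o" := (oone : O).

Lemma polarDl u v w : P (u + v) w = P u w + P v w.
Proof. exact: linearD (opolarr w) u v. Qed.
Lemma polarZl s u w : P (s *: u) w = s * P u w.
Proof. by rewrite -[LHS]/(opolarr w _) linearZ. Qed.
Lemma polarNl u w : P (- u) w = - P u w.
Proof. exact: linearN (opolarr w) u. Qed.
Lemma polar0l w : P 0 w = 0.
Proof. exact: linear0 (opolarr w). Qed.
Lemma polarDr u v w : P w (u + v) = P w u + P w v.
Proof. by rewrite !(opolarC w) polarDl. Qed.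
Lemma polarZr s u w : P w (s *: u) = s * P w u.
Proof. by rewrite !(opolarC w) polarZl. Qed.
Lemma polarNr u w : P w (- u) = - P w u.
Proof. by rewrite !(opolarC w) polarNl. Qed.
Lemma polar0r w : P w 0 = 0.
Proof. by rewrite opolarC polar0l. Qed.

Lemma omulDl u v w : (u + v) ** w = u ** w + v ** w.
Proof. exact: linearD (omulr w) u v. Qed.
Lemma omulZl s u w : (s *: u) ** w = s *: (u ** w).
Proof. by rewrite -[LHS]/(omulr w _) linearZ. Qed.
Lemma omulNl u w : (- u) ** w = - (u ** w).
Proof. exact: linearN (omulr w) u. Qed.
Lemma omulDr u v w : w ** (u + v) = w ** u + w ** v.
Proof. exact: linearD. Qed.
Lemma omulZr s u w : w ** (s *: u) = s *: (w ** u).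
Proof. by rewrite linearZ. Qed.
Lemma omulNr u w : w ** (- u) = - (w ** u).
Proof. exact: linearN. Qed.

Definition omulE := (@omul1x k O, @omulx1 k O, omulDl, omulDr, omulZl, omulZr, omulNl, omulNr).
Definition polarE := (polarDl, polarDr, polarZl, polarZr, polarNl, polarNr, polar0l, polar0r).

Lemma polar_inj u v : (forall y, P u y = P v y) -> u = v.
Proof.
move=> uv; apply/eqP; rewrite -subr_eq0; apply/eqP/onorm_nondeg => y.
by rewrite polarDl polarNl uv subrr.
Qed.

Lemma onorm1 : onorm 1o = 1.
Proof.
have := oconj_mulK 1o 1o; rewrite !omulx1 => E.
have /eqP := onormM 1o 1o; rewrite omul1x -[X in X == _]mulr1.
have [n0 _|n0] := eqVneq (onorm 1o) 0; last by move/eqP/(mulfI n0).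
case/eqP: (oone_neq0 (s := O)); apply: polar_inj => y.
by have := opolarMl 1o y 1o; rewrite omul1x omulx1 n0 mul0r opolarC polar0l.
Qed.

Lemma polar11 : P 1o 1o = 2%:R.
Proof.
have [nZ _] := @onorm_quadratic k O.
rewrite /polar -mulr2n -scaler_nat nZ onorm1; ring.
Qed.

(** The polarization in the left factor of P (v x) (v z) = q(v) P x z; all the
    identities below come from this one. *)
Lemma polar_exchange v x y z : P (v ** x) (y ** z) + P (y ** x) (v ** z) = P v y * P x z.
Proof.
have := opolarMl (v + y) x z; rewrite !omulE !polarE !opolarMl.
have -> : onorm (v + y) = P v y + onorm v + onorm y by rewrite /polar; ring.
by move=> E; apply: (eq_of_eqB E); ring.
Qed.

Lemma polar_oconjr u x y : P (x ** oconj u) y = P x (y ** u).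
Proof.
have E := polar_exchange x u y 1o; rewrite !omulx1 in E.
rewrite /oconj !omulE !polarE [P x (y ** u)]opolarC; apply: (eq_of_eqB (esym E)); ring.
Qed.

Lemma polar_oconj u v : P (oconj u) (oconj v) = P u v.
Proof. by rewrite /oconj !polarE polar11 (opolarC 1o v); ring. Qed.

Lemma polar_mulr u x y : P (x ** u) y = P x (y ** oconj u).
Proof. by rewrite opolarC -polar_oconjr opolarC. Qed.

Lemma omul_oconj_polar v w : v ** oconj w + w ** oconj v = P v w *: 1o.
Proof.
have E := omul_oconj (v + w).
have oD : oconj (v + w) = oconj v + oconj w := linearD _ _ _.
rewrite oD omulDl !(omulDr (oconj v) (oconj w)) !omul_oconj in E.
apply: polar_inj => y; have {}E := congr1 (P^~ y) E; rewrite !polarE in E *.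
by apply: (eq_of_eqB E); rewrite /(P v w); ring.
Qed.

(** For v = w this is the Moufang identity (v u^) v = P u v v - q(v) u. *)
Lemma moufang_polar u v w : (v ** oconj u) ** w + (w ** oconj u) ** v =
  P u v *: w + P u w *: v - P v w *: u.
Proof.
apply: polar_inj => y; rewrite !polarE !(polar_mulr _ (_ ** _)).
have E1 := polar_exchange v (oconj u) y (oconj w).
have E2 := polar_exchange w (oconj u) y (oconj v).
have E3 : P (y ** oconj u) (v ** oconj w) + P (y ** oconj u) (w ** oconj v) =
    P v w * P u y.
  by rewrite -polarDr omul_oconj_polar polarZr polar_oconjr omul1x (opolarC y).
move: E1 E2; rewrite !polar_oconj => E1 E2.
apply: (eq_of_eqB E1); apply: (eq_of_eqB E2); apply: (eq_of_eqB (esym E3)).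
ring.
Qed.

Lemma mem_oim_polar u : (u \in oim O) = (P u 1o == 0).
Proof.
rewrite mem_oim /oconj -subr_eq0 opprK subrK scaler_eq0.
by rewrite (negPf (oone_neq0 (s := O))) orbF.
Qed.

Lemma oim_polar1 u : u \in oim O -> P u 1o = 0.
Proof. by rewrite mem_oim_polar => /eqP. Qed.

Lemma oim_oconj u : u \in oim O -> oconj u = - u.
Proof. by rewrite mem_oim => /eqP. Qed.

Lemma polar_oiml a x y : a \in oim O -> P (a ** x) y = - P x (a ** y).
Proof. by move=> aI; rewrite -opolar_oconj oim_oconj // omulNl polarNl opprK. Qed.

Lemma polar_oimr a x y : a \in oim O -> P (x ** a) y = - P x (y ** a).
Proof. by move=> aI; rewrite polar_mulr oim_oconj // omulNr polarNr. Qed.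

(** The Clifford relation L_a L_b + L_b L_a = - P a b, and below its analogue for
    right multiplications. *)
Lemma oim_clifford a b x : a \in oim O -> b \in oim O ->
  a ** (b ** x) = - (b ** (a ** x)) - P a b *: x.
Proof.
move=> aI bI; apply: polar_inj => y; rewrite !polarE.
rewrite (polar_oiml (b ** x)) // (polar_oiml (a ** x)) //.
by apply: (eq_of_eqB (esym (polar_exchange a x b y))); ring.
Qed.

Lemma oim_cliffordr a b x : a \in oim O -> b \in oim O ->
  (x ** a) ** b = - ((x ** b) ** a) - P a b *: x.
Proof.
move=> aI bI; apply: polar_inj => y; rewrite !polarE.
rewrite (polar_oimr (x ** a)) // (polar_oimr (x ** b)) //.
apply: (eq_of_eqB (esym (polar_exchange x a y b))).
by rewrite (opolarC (y ** a)); ring.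
Qed.

Lemma oim_anticomm a b : a \in oim O -> b \in oim O ->
  a ** b = - (b ** a) - P a b *: 1o.
Proof. by move=> aI bI; have := oim_clifford 1o aI bI; rewrite !omulx1. Qed.

Definition ocomm x y := x ** y - y ** x.

Lemma ocomm_oim a b : a \in oim O -> b \in oim O -> ocomm a b \in oim O.
Proof.
move=> aI bI; rewrite mem_oim_polar /ocomm polarDl polarNl !polar_oiml // !omulx1.
by rewrite (opolarC b) subrr.
Qed.

Lemma polar_ocomm a b x : a \in oim O -> b \in oim O ->
  P (ocomm a b) x = P b (ocomm x a).
Proof.
move=> aI bI; rewrite /ocomm !polarE polar_oiml // polar_oimr //.
by rewrite addrC opprK.
Qed.

Hypothesis k2 : 2%N \notin [pchar k].

Lemma nat2_neq0 : 2%:R != 0 :> k.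
Proof. by move: k2; rewrite inE. Qed.

Lemma oim_decomp v : exists t, exists2 a, a \in oim O & v = t *: 1o + a.
Proof.
pose t := P v 1o / 2%:R; exists t, (v - t *: 1o); last by rewrite addrC subrK.
by rewrite mem_oim_polar !polarE polar11 /t divfK ?nat2_neq0 // subrr.
Qed.

Lemma oim_nondeg a : a \in oim O ->
  (forall b, b \in oim O -> P a b = 0) -> a = 0.
Proof.
move=> aI a0; apply: polar_inj => y; have [t [b bI ->]] := oim_decomp y.
by rewrite !polarE oim_polar1 // a0 // mulr0 addr0.
Qed.

(** Im O is the kernel of u |-> u + u^ = P u 1, whose image is the line of 1. *)
Lemma dim_oim : (\dim (oim O)).+1 = \dim {:O}.
Proof.
rewrite -[RHS](limg_ker_dim (linfun (@oconj k O) + \1)%VF) capfv -addn1.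
congr (_ + _)%N.
have -> : limg (linfun (@oconj k O) + \1)%VF = <[1o]>%VS.
  apply/eqP; rewrite eqEsubv; apply/andP; split; apply/subvP => x.
    case/memv_imgP => u _ ->; rewrite add_lfunE id_lfunE lfunE /= /oconj subrK.
    by rewrite memvZ ?memv_line.
  case/vlineP => t ->; apply/memvZ/memv_imgP; exists (2%:R^-1 *: 1o); rewrite ?memvf //.
  rewrite add_lfunE id_lfunE lfunE /= /oconj subrK polarZl polar11 mulVf ?nat2_neq0 //.
  by rewrite scale1r.
by rewrite dim_vline oone_neq0.
Qed.

Lemma oim_dual_bases : exists e e' : 'I_(\dim (oim O)) -> subvs_of (oim O),
  [/\ forall i, P (vsval (e i)) (vsval (e' i)) = 1,
      forall p, \sum_i P (vsval p) (vsval (e' i)) *: e i = p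
    & forall p, \sum_i P (vsval p) (vsval (e i)) *: e' i = p].
Proof.
pose b (u v : subvs_of (oim O)) := P (vsval u) (vsval v).
have bl p : scalar (b ^~ p) by move=> t q r; rewrite /b linearP /= polarDl polarZl.
have bC p q : b p q = b q p by apply: opolarC.
have b0 p : (forall q, b p q = 0) -> p = 0.
  move=> p0; apply: val_inj; apply: oim_nondeg (subvsP p) _ => v vI.
  by have := p0 (vsproj (oim O) v); rewrite /b vsprojK.
have := dual_bases bl bC b0.
by rewrite dimvf.
Qed.

End CompositionAlgebra.

(** The form is nondegenerate, so that an identity between vectors can be
    tested by pairing with an arbitrary vector, which turns it into one for
    ring. *)
Local Ltac omodring := apply: polar_inj => ?; rewrite !polarE; ring.

(** * Candidates for the values of the moment map *)

Section SpinOperators.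
Variables (k : fieldType) (O : compositionType k).
Hypothesis k2 : 2%N \notin [pchar k].
Implicit Types (a b c u v w x y z : O) (s t : k).

Local Notation P := (polar (@onorm k O)).
Local Notation "x ** y" := (omul x y) (at level 40, left associativity).
Local Notation "1o" := (oone : O).

Definition lmul u : 'End(O) := linfun (omul u).

Lemma lmulE u z : lmul u z = u ** z.
Proof. exact: lfunE. Qed.

Lemma lmul_is_linear : linear lmul.
Proof.
move=> t u v; apply/lfunP => x.
by rewrite add_lfunE scale_lfunE !lmulE omulDl omulZl.
Qed.
HB.instance Definition _ :=
  GRing.isSemilinear.Build k O 'End(O) _ lmul (GRing.semilinear_linear lmul_is_linear).

Definition wedge_fun v w z := P v z *: w - P w z *: v.
Lemma wedge_fun_is_linear v w : linear (wedge_fun v w).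
Proof. by move=> t x y; rewrite /wedge_fun; omodring. Qed.
HB.instance Definition _ v w := GRing.isSemilinear.Build k O O _ (wedge_fun v w)
  (GRing.semilinear_linear (wedge_fun_is_linear v w)).
Definition wedge v w : 'End(O) := linfun (wedge_fun v w).

Lemma wedgeE v w z : wedge v w z = P v z *: w - P w z *: v.
Proof. exact: lfunE. Qed.

(** Six times the action of the moment of v and w. As w v^ has real part P v w / 2,
    the last two terms add up to -2 L_c with c the imaginary part of w v^. *)
Definition spin_fun v w z :=
  4%:R *: (P v z *: w - P w z *: v) - 2%:R *: (w ** oconj v) ** z + P v w *: z.
Lemma spin_fun_is_linear v w : linear (spin_fun v w).
Proof.
move=> t x y; rewrite /spin_fun; move: (_ ** oconj _) => c.
by rewrite !omulE; omodring.
Qed.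
HB.instance Definition _ v w := GRing.isSemilinear.Build k O O _ (spin_fun v w)
  (GRing.semilinear_linear (spin_fun_is_linear v w)).
Definition spin_op v w : 'End(O) := linfun (spin_fun v w).

Lemma spin_opE v w z : spin_op v w z =
  4%:R *: (P v z *: w - P w z *: v) - 2%:R *: (w ** oconj v) ** z + P v w *: z.
Proof. exact: lfunE. Qed.

Lemma oconj1 : oconj 1o = 1o.
Proof. by rewrite /oconj polar11; omodring. Qed.

Lemma spin_op1E w z : w \in oim O -> spin_op 1o w z =
  4%:R *: (P 1o z *: w - P w z *: 1o) - 2%:R *: w ** z.
Proof.
by move=> wI; rewrite spin_opE oconj1 omulx1 (opolarC 1o w) oim_polar1 // scale0r addr0.
Qed.

(** The Clifford commutator [[u, v], a] as an operator; it is again a left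
    multiplication, so that S normalizes the L_a. *)
Lemma lmul_bracket3 u v a : u \in oim O -> v \in oim O -> a \in oim O ->
  lfbracket (lfbracket (lmul u) (lmul v)) (lmul a) =
  lmul ((2%:R * P u a) *: v - (2%:R * P v a) *: u).
Proof.
move=> uI vI aI; apply/lfunP => x; rewrite !lfbracketE !lmulE.
rewrite !omulE (oim_clifford (v ** x) aI uI) (oim_clifford (u ** x) aI vI).
rewrite (oim_clifford x aI uI) (oim_clifford x aI vI) !omulE.
by rewrite (opolarC u) (opolarC v); omodring.
Qed.

Section DualBases.
Variables e e' : 'I_(\dim (oim O)) -> subvs_of (oim O).
Hypotheses (ee' : forall i, P (vsval (e i)) (vsval (e' i)) = 1)
  (esum : forall p, \sum_i P (vsval p) (vsval (e' i)) *: e i = p)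
  (e'sum : forall p, \sum_i P (vsval p) (vsval (e i)) *: e' i = p).

Lemma oim_esum a : a \in oim O ->
  \sum_i P a (vsval (e' i)) *: vsval (e i) = a.
Proof.
move=> aI; have := congr1 vsval (esum (vsproj _ a)); rewrite vsprojK // => {2}<-.
by rewrite linear_sum; apply: eq_bigr => i _; rewrite linearZ.
Qed.

Lemma oim_e'sum a : a \in oim O ->
  \sum_i P a (vsval (e i)) *: vsval (e' i) = a.
Proof.
move=> aI; have := congr1 vsval (e'sum (vsproj _ a)); rewrite vsprojK // => {2}<-.
by rewrite linear_sum; apply: eq_bigr => i _; rewrite linearZ.
Qed.

(** The Lie algebra acts on Im O through commutators with the L_a, and
    spin_op 1 w has to act there by a multiple of a |-> [w, a]. This sum, which
    retrieves an element of the Lie algebra from its action, is therefore a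
    multiple of spin_op 1 w. *)
Definition spin_sum w : 'End(O) :=
  \sum_i lfbracket (lmul (vsval (e i))) (lmul (ocomm w (vsval (e' i)))).

(** By symmetry of the dual bases twice the sum is the sum of the
    e (e' x) + e' (e x) = - P e e' x. *)
Lemma sum_mull x : 2%:R *: \sum_i vsval (e i) ** (vsval (e' i) ** x) =
  - (\dim (oim O))%:R *: x.
Proof.
pose F (p q : subvs_of (oim O)) := vsval p ** (vsval q ** x).
have FC : \sum_i F (e i) (e' i) = \sum_i F (e' i) (e i).
  apply: (dual_sumC (b := fun p q => P (vsval p) (vsval q)) _ e'sum) => [p q|q|p].
  - exact: opolarC.
  - by move=> t p r; rewrite /F linearP /= ?omulE.
  - by move=> t q r; rewrite /F linearP /= ?omulE.
rewrite scaler_nat mulr2n {2}FC -big_split /= /F.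
rewrite (eq_bigr (fun=> - x)) => [|i _].
  by rewrite sumr_const card_ord scaleNr scaler_nat mulNrn.
by rewrite oim_clifford ?subvsP // ee' scale1r addrAC addNr add0r.
Qed.

Lemma sum_mulr x : 2%:R *: \sum_i (x ** vsval (e' i)) ** vsval (e i) =
  - (\dim (oim O))%:R *: x.
Proof.
pose F (p q : subvs_of (oim O)) := (x ** vsval q) ** vsval p.
have FC : \sum_i F (e i) (e' i) = \sum_i F (e' i) (e i).
  apply: (dual_sumC (b := fun p q => P (vsval p) (vsval q)) _ e'sum) => [p q|q|p].
  - exact: opolarC.
  - by move=> t p r; rewrite /F linearP /= ?omulE.
  - by move=> t q r; rewrite /F linearP /= ?omulE.
rewrite scaler_nat mulr2n {2}FC -big_split /= /F.
rewrite (eq_bigr (fun=> - x)) => [|i _].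
  by rewrite sumr_const card_ord scaleNr scaler_nat mulNrn.
by rewrite addrC oim_cliffordr ?subvsP // ee' scale1r addrAC addNr add0r.
Qed.

Lemma spin_sum1 w : w \in oim O ->
  spin_sum w 1o = (2 * \dim (oim O))%:R *: w - 2%:R *: w.
Proof.
move=> wI; rewrite /spin_sum sum_lfunE.
transitivity (\sum_i (- 2%:R *: (vsval (e i) ** (vsval (e' i) ** w)) +
    - 2%:R *: ((w ** vsval (e' i)) ** vsval (e i)) -
    2%:R *: (P w (vsval (e' i)) *: vsval (e i)))).
  apply: eq_bigr => i _; have eI := subvsP (e i); have e'I := subvsP (e' i).
  rewrite lfbracketE !lmulE !omulx1 /ocomm; set x := vsval (e i) in eI *.
  set y := vsval (e' i) in e'I *.
  have E1 : x ** (w ** y) = - (x ** (y ** w)) - P w y *: x.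
    by rewrite (oim_anticomm wI e'I) !omulE.
  have E2 : (y ** w) ** x = - ((w ** y) ** x) - P w y *: x.
    by rewrite (oim_anticomm e'I wI) !omulE opolarC.
  by rewrite !omulE E1 E2; omodring.
rewrite sumrB big_split /= -!scaler_sumr !scaleNr sum_mull sum_mulr oim_esum //.
by rewrite natrM mulr_natl scaleNr opprK -scalerDl -mulr2n.
Qed.

Lemma spin_sum_bracket w a : w \in oim O -> a \in oim O ->
  lfbracket (spin_sum w) (lmul a) = 4%:R *: lmul (ocomm w a).
Proof.
move=> wI aI; rewrite -linearZ /=.
have brD (I : finType) (f : I -> 'End(O)) g :
    lfbracket (\sum_i f i) g = \sum_i lfbracket (f i) g.
  apply/lfunP => x; rewrite lfbracketE !sum_lfunE linear_sum -sumrB.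
  by apply: eq_bigr => i _; rewrite lfbracketE.
rewrite brD; under eq_bigr => i _ do
  rewrite lmul_bracket3 ?ocomm_oim ?subvsP // polar_ocomm ?subvsP //.
rewrite -linear_sum; congr lmul.
have ocl u : linear (ocomm u).
  by move=> t x y; rewrite /ocomm !omulE; omodring.
rewrite sumrB; under eq_bigr => i _ do rewrite -scalerA opolarC.
under [in X in _ - X]eq_bigr => i _ do rewrite -scalerA opolarC.
rewrite -!scaler_sumr -(linear_sumZ (ocl w)) oim_esum ?ocomm_oim //.
rewrite oim_e'sum // /ocomm; omodring.
Qed.

(** The commutator with L_a gives the value a (12 w) + 4 [w, a] of the sum at an
    imaginary a, from its value (2 * 7 - 2) w = 12 w at 1. *)
Lemma spin_sumE w : \dim {:O} = 8%N -> w \in oim O ->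
  spin_sum w = 2%:R *: spin_op 1o w.
Proof.
move=> O8 wI; apply/lfunP => x; have [t [a aI ->]] := oim_decomp k2 x.
have dI : \dim (oim O) = 7%N by apply: succn_inj; rewrite (dim_oim _ k2).
have D1 := spin_sum1 wI; rewrite dI in D1.
have Da : spin_sum w a = a ** spin_sum w 1o + 4%:R *: ocomm w a ** 1o.
  have := congr1 (fun f : 'End(O) => f 1o) (spin_sum_bracket wI aI).
  rewrite /= lfbracketE scale_lfunE !lmulE omulx1 => /eqP.
  by rewrite subr_eq omulZl addrC => /eqP.
rewrite linearP /= Da D1 scale_lfunE spin_op1E // /ocomm !omulE !polarE.
rewrite (opolarC 1o a) (oim_polar1 aI) (oim_polar1 wI) polar11 (oim_anticomm aI wI).
by rewrite (opolarC w a); omodring.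
Qed.

End DualBases.
End SpinOperators.

Section OctonionDimension.
Variables (k : fieldType) (O : compositionType k).
Hypothesis k2 : 2%N \notin [pchar k].
Hypothesis O8 : \dim {:O} = 8%N.
Implicit Types (a b c u v w x y z : O) (s t : k).

Local Notation P := (polar (@onorm k O)).
Local Notation "x ** y" := (omul x y) (at level 40, left associativity).
Local Notation "1o" := (oone : O).

Lemma spin_op_linearl w : linear (@spin_op k O ^~ w).
Proof.
move=> t u v; apply/lfunP => x; rewrite [LHS]spin_opE [RHS]add_lfunE scale_lfunE !spin_opE.
have -> : oconj (t *: u + v) = t *: oconj u + oconj v := linearP _ _ _ _.
rewrite (omulDr (t *: oconj u)) (omulZr t (oconj u)) !(omulDl, omulZl) !polarE.
omodring.
Qed.

Lemma spin_op_linearr v : linear (@spin_op k O v).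
Proof.
move=> t u w; apply/lfunP => x; rewrite [LHS]spin_opE [RHS]add_lfunE scale_lfunE !spin_opE.
by rewrite !(omulDl, omulZl) !polarE; omodring.
Qed.

Lemma spin_opxx v : spin_op v v = 0.
Proof.
apply/lfunP => x; rewrite spin_opE subrr scaler0 add0r omul_oconj !omulE.
have -> : P v v = 2%:R * onorm v.
  by have := opolarMl v 1o 1o; rewrite !omulx1 polar11 => ->; ring.
by rewrite zero_lfunE scalerA addNr.
Qed.

(** With v /\ w for the rotation z |-> B(v, z) w - B(w, z) v one has
    spin_op 1 w = 8 (1 /\ w) - 2 L_w; the term 64 [1 /\ v, 1 /\ w] = 64 (v /\ w)
    of the commutator and the contributions - 32 (v /\ w) of the mixed terms
    leave 4 times the term 8 (v /\ w) of spin_op v w. *)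
Lemma spin_op_oim v w : v \in oim O -> w \in oim O ->
  4%:R *: spin_op v w = lfbracket (spin_op 1o v) (spin_op 1o w) +
    2%:R *: spin_op 1o (ocomm v w) - 4%:R *: lfbracket (lmul v) (lmul w).
Proof.
move=> vI wI; apply/lfunP => x.
have E (f g h : 'End(O)) : (f + 2%:R *: g - 4%:R *: h) x =
    f x + 2%:R *: g x - 4%:R *: h x.
  by rewrite !(add_lfunE, opp_lfunE, scale_lfunE).
rewrite {}E scale_lfunE !lfbracketE !lmulE.
rewrite !spin_op1E ?ocomm_oim // spin_opE oim_oconj // /ocomm.
have PvI : P 1o v = 0 by rewrite opolarC oim_polar1.
have PwI : P 1o w = 0 by rewrite opolarC oim_polar1.
have Pm a y z : a \in oim O -> P z (a ** y) = - P y (a ** z).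
  by move=> aI; rewrite opolarC polar_oiml.
rewrite !omulE (oim_anticomm wI vI) !omulE !polarE polar11 PvI PwI.
rewrite (Pm v x) // (Pm w x) // (Pm w x v) // (Pm v x w) //.
rewrite (oim_anticomm wI vI) !omulE !polarE !(opolarC _ 1o) PvI PwI.
rewrite (opolarC w v) (opolarC x v) (opolarC x w) (opolarC x (v ** w)).
omodring.
Qed.

Lemma spin_op1_bracket w a : w \in oim O -> a \in oim O ->
  lfbracket (spin_op 1o w) (lmul a) = 2%:R *: lmul (ocomm w a).
Proof.
move=> wI aI; have [e [e' [ee' eS e'S]]] := oim_dual_bases O k2.
have := spin_sum_bracket eS e'S wI aI; rewrite (spin_sumE k2 ee' eS e'S O8 wI).
move=> E; apply: (scalerI (nat2_neq0 k2)).
rewrite scalerA -natrM -E; apply/lfunP => x.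
rewrite scale_lfunE !lfbracketE !scale_lfunE linearZ /= -scalerBr //.
Qed.

Section MemSpin.
Variable S : {vspace 'End(O)}.
Hypothesis S_lmul : forall a b, a \in oim O -> b \in oim O ->
  lfbracket (lmul a) (lmul b) \in S.

Lemma spin_op1_mem w : w \in oim O -> spin_op 1o w \in S.
Proof.
move=> wI; have [e [e' [ee' eS e'S]]] := oim_dual_bases O k2.
have E := spin_sumE k2 ee' eS e'S O8 wI.
have -> : spin_op 1o w = 2%:R^-1 *: spin_sum e e' w.
  by rewrite E (scalerK (nat2_neq0 k2)).
apply/memvZ/memv_suml => i _.
by apply: S_lmul; rewrite ?ocomm_oim ?subvsP.
Qed.

Hypothesis S_bracket : forall f g, f \in S -> g \in S -> lfbracket f g \in S.

Lemma spin_op_mem v w : spin_op v w \in S.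
Proof.
have [s [a aI ->]] := oim_decomp k2 v; have [t [b bI ->]] := oim_decomp k2 w.
have Dl q x y z : spin_op (q *: x + y) z = q *: spin_op x z + spin_op y z.
  exact: spin_op_linearl.
have Dr q x y z : spin_op z (q *: x + y) = q *: spin_op z x + spin_op z y.
  exact: spin_op_linearr.
have alt c : spin_op c 1o = - spin_op 1o c.
  apply/eqP; rewrite -addr_eq0; apply/eqP; have := spin_opxx (1 *: c + 1o).
  by rewrite Dl !Dr !scale1r !spin_opxx add0r addr0.
rewrite Dl !Dr spin_opxx scaler0 add0r alt; apply: memvD.
  exact/memvZ/spin_op1_mem.
apply: memvD; first by apply: memvZ; rewrite memvN spin_op1_mem.
have n4 : 4%:R != 0 :> k.
  have -> : 4%:R = 2%:R * 2%:R :> k by ring.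
  by apply: mulf_neq0; exact: nat2_neq0.
rewrite -[spin_op a b](scalerK n4).
apply: memvZ; rewrite spin_op_oim //; apply: memvB; last by rewrite memvZ ?S_lmul.
by apply: memvD; rewrite ?memvZ ?S_bracket ?spin_op1_mem ?ocomm_oim.
Qed.
End MemSpin.

(** By the Clifford relation and tr (L_a L_b) = tr (L_b L_a), twice the trace is
    - P a b tr 1. *)
Lemma lftrace_lmul2 a b : a \in oim O -> b \in oim O ->
  lftrace (lmul a \o lmul b)%VF = - 4%:R * P a b.
Proof.
move=> aI bI; apply: (mulfI (nat2_neq0 k2)).
rewrite mulr_natl mulr2n {2}lftraceC -linearD /=.
have -> : (lmul a \o lmul b)%VF + (lmul b \o lmul a)%VF = (- P a b) *: \1%VF.
  apply/lfunP => x; rewrite add_lfunE scale_lfunE id_lfunE !comp_lfunE !lmulE.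
  by rewrite (oim_clifford x aI bI) addrAC addNr add0r scaleNr.
by rewrite linearZ /= lftrace1 O8; ring.
Qed.

Lemma lftrace_wedge (f : 'End(O)) v w :
  lftrace (f \o wedge v w)%VF = P v (f w) - P w (f v).
Proof.
rewrite (@lftrace_rank2 _ _ (opolarr v) (opolarr w) (f w) (- f v)).
  by rewrite /= /opolarr polarNl !(opolarC (f _)).
move=> z; rewrite comp_lfunE wedgeE linearB !linearZ /= /opolarr.
by rewrite !(opolarC z) scalerN.
Qed.

Lemma spin_op_wedge v w :
  spin_op v w = 4%:R *: wedge v w - 2%:R *: lmul (w ** oconj v) + P v w *: \1%VF.
Proof.
apply/lfunP => x; rewrite [RHS]add_lfunE [X in _ = X + _]add_lfunE opp_lfunE !scale_lfunE.
by rewrite id_lfunE wedgeE lmulE spin_opE omulZl.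
Qed.

Lemma lftrace_spin_op (f : 'End(O)) v w : lftrace (f \o spin_op v w)%VF =
  4%:R * (P v (f w) - P w (f v)) - 2%:R * lftrace (f \o lmul (w ** oconj v))%VF +
  P v w * lftrace f.
Proof.
rewrite spin_op_wedge !comp_lfunDr comp_lfunNr -!comp_lfunZr comp_lfun1r.
by rewrite !(linearD, linearN, linearZ) /= lftrace_wedge.
Qed.

(** This orthogonality of S to the left multiplications uses dim O = 8: it fails
    for quaternions, where the L_c belong to S. Expressing L_c by the rotation in
    the plane of 1 and c and by spin_op 1 c turns the trace into two terms that
    cancel: the rotation contributes P c (ab - ba), and spin_op 1 c, through its
    commutator with L_b, a trace of two left multiplications. *)
Lemma lftrace_lmul3 a b c : a \in oim O -> b \in oim O -> c \in oim O ->
  lftrace (lfbracket (lmul a) (lmul b) \o lmul c)%VF = 0.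
Proof.
move=> aI bI cI; set g := lfbracket _ _.
have T1 : lftrace (g \o spin_op 1o c)%VF = 8%:R * P a (ocomm c b).
  rewrite lftrace_bracket.
  have -> : lfbracket (lmul b) (spin_op 1o c) = - 2%:R *: lmul (ocomm c b).
    by rewrite scaleNr -spin_op1_bracket // /lfbracket opprB.
  by rewrite -comp_lfunZr linearZ /= lftrace_lmul2 ?ocomm_oim //; ring.
have T2 : lftrace (g \o wedge 1o c)%VF = - 2%:R * P c (ocomm a b).
  rewrite lftrace_wedge /g !lfbracketE !lmulE !omulx1 /ocomm.
  rewrite !polarE !(opolarC 1o) !polar_oiml // !omulx1.
  by ring.
apply: (mulfI (nat2_neq0 k2)); rewrite mulr0.
have := lftrace_spin_op g 1o c; rewrite T1 oconj1 omulx1 (opolarC 1o c) oim_polar1 //.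
rewrite mul0r addr0 -lftrace_wedge T2 (opolarC a) (opolarC c).
rewrite (polar_ocomm a cI bI) (polar_ocomm c aI bI) /ocomm => E.
by apply: (eq_of_eqB E); rewrite !polarE; ring.
Qed.

End OctonionDimension.

(** * The spinor representation *)

Section SpinorRepresentation.
Variables (k : fieldType) (O : compositionType k).
Variable C : cliffordAlgebra (oim_quad O).
Hypothesis k2 : 2%N \notin [pchar k].
Implicit Types (u v w : O) (x y : clifford2_type C).

Local Notation P := (polar (@onorm k O)).
Local Notation "x ** y" := (omul x y) (at level 40, left associativity).
Local Notation rho := (@spinor_rep k O C).

Lemma clifford_rep_commr (x y : C) :
  clifford_rep C (commr x y) = lfbracket (clifford_rep C x) (clifford_rep C y).
Proof. by rewrite /commr rmorphB !rmorphM. Qed.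

Lemma spinor_rep_lie x y : rho (lie x y) = lfbracket (rho x) (rho y).
Proof.
by rewrite /spinor_rep -clifford_rep_commr -val_clifford2_lie.
Qed.

Lemma spinor_rep_commr (p q : subvs_of (oim O)) :
  rho (vsproj (clifford2 C) (commr (clifford_in C p) (clifford_in C q))) =
  lfbracket (lmul (vsval p)) (lmul (vsval q)).
Proof.
rewrite /spinor_rep vsprojK ?clifford2_in // clifford_rep_commr.
by rewrite /clifford_rep !clifford_lift_in.
Qed.

Lemma spinor_rep_ind (T : 'End(O) -> Prop) :
  (forall a f g, T f -> T g -> T (a *: f + g)) -> T 0 ->
  (forall a b, a \in oim O -> b \in oim O -> T (lfbracket (lmul a) (lmul b))) ->
  forall x, T (rho x).
Proof.
move=> TP T0 Tl; apply: (clifford2_ind (T := fun x => T (rho x))).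
- by move=> a x y Tx Ty; rewrite linearP; apply: TP.
- by rewrite linear0.
- by move=> p q; rewrite spinor_rep_commr; apply: Tl; apply: subvsP.
Qed.

Lemma polar_spinor_rep x v w : P (rho x v) w = - P v (rho x w).
Proof.
elim/spinor_rep_ind: (rho x) v w => [a f g fS gS|| a b aI bI] v w.
- by rewrite !(add_lfunE, scale_lfunE) !polarE fS gS; ring.
- by rewrite !zero_lfunE !polarE oppr0.
rewrite !lfbracketE !lmulE !polarE (polar_oiml (b ** v)) // (polar_oiml (a ** v)) //.
by rewrite (polar_oiml v (a ** w)) // (polar_oiml v (b ** w)) //; ring.
Qed.

Lemma lftrace_spinor_rep x : lftrace (rho x) = 0.
Proof.
elim/spinor_rep_ind: (rho x) => [a f g fS gS|| a b aI bI].
- by rewrite linearP /= fS gS mulr0 addr0.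
- by rewrite linear0.
by rewrite /lfbracket linearB /= lftraceC subrr.
Qed.

Lemma polar_oim_quad (p q : subvs_of (oim O)) :
  polar (oim_quad O) p q = - P (vsval p) (vsval q).
Proof. by rewrite /polar /oim_quad linearD /=; ring. Qed.

Lemma commr_clifford_in x p :
  exists q, commr (vsval x) (clifford_in C p) = clifford_in C q.
Proof.
elim/clifford2_ind: x => [a x y [q xq] [r yr]||u v].
- exists (a *: q + r).
  by rewrite linearP /= -[LHS]/(commrr _ _) linearP /= /commrr xq yr -linearP.
- by exists 0; rewrite !linear0 -[LHS]/(commrr _ _) linear0.
by rewrite vsprojK ?clifford2_in // commr3; eexists.
Qed.

(** The action of x on Im O by commutators determines x. For x = [u, v] the
    commutator formula gives 2 (P u e' v - P v e' u) for [x, e'], and summation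
    over the dual bases yields 2 (uv - vu). *)
Lemma sum_clifford_in (e e' : 'I_(\dim (oim O)) -> subvs_of (oim O)) x :
  (forall p, \sum_i P (vsval p) (vsval (e' i)) *: e i = p) ->
  \sum_i clifford_in C (e i) * commr (vsval x) (clifford_in C (e' i)) =
  2%:R *: vsval x.
Proof.
move=> esum; elim/clifford2_ind: x => [a x y xE yE||u v].
- have cl X Y Z : commr (a *: X + Y) Z = a *: commr X Z + commr Y Z.
    by rewrite -[LHS]/(commrr Z _) linearP.
  rewrite linearP /= scalerDr scalerA [_ * a]mulrC -scalerA -xE -yE scaler_sumr.
  rewrite -big_split; apply: eq_bigr => i _.
  by rewrite /= cl mulrDr -scalerAr.
- rewrite linear0 scaler0 big1 // => i _.
  by rewrite /commr mul0r mulr0 subrr mulr0.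
rewrite vsprojK ?clifford2_in //.
transitivity (\sum_i (2%:R *: (clifford_in C (P (vsval u) (vsval (e' i)) *: e i) * clifford_in C v)
   - 2%:R *: (clifford_in C (P (vsval v) (vsval (e' i)) *: e i) * clifford_in C u))).
  apply: eq_bigr => i _; rewrite commr3 !polar_oim_quad.
  set s := P (vsval v) _; set t := P (vsval u) _.
  have -> : (- s *+ 2) *: u - (- t *+ 2) *: v = 2%:R *: (t *: v - s *: u).
    by rewrite scaler_nat -!scalerMnl -mulrnBl !scaleNr opprK addrC.
  rewrite [clifford_in C (2%:R *: _)]linearZ -scalerAr -scalerBr; congr (_ *: _).
  rewrite [clifford_in C (_ - _)]linearB !linearZ /= mulrDr -!scalerAr -!scalerAl.
  by rewrite mulrN scalerN.
rewrite sumrB -!scaler_sumr -scalerBr; congr (_ *: _).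
by rewrite -!mulr_suml -!linear_sum !esum.
Qed.

Lemma spinor_rep_oim x p :
  exists q, lfbracket (rho x) (lmul (vsval p)) = lmul (vsval q) /\
    commr (vsval x) (clifford_in C p) = clifford_in C q.
Proof.
have [q xq] := commr_clifford_in x p; exists q; split=> //.
have := clifford_rep_commr (vsval x) (clifford_in C p).
by rewrite xq /clifford_rep !clifford_lift_in.
Qed.

Hypothesis O8 : \dim {:O} = 8%N.

Lemma lftrace_spinor_rep_bracket x (p q q' : subvs_of (oim O)) :
  lfbracket (rho x) (lmul (vsval p)) = lmul (vsval q') ->
  lftrace (rho x \o lfbracket (lmul (vsval p)) (lmul (vsval q)))%VF =
  - 4%:R * P (vsval q') (vsval q).
Proof. by move=> E; rewrite -lftrace_bracket E lftrace_lmul2 ?subvsP. Qed.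

Hypothesis k3 : 3%N \notin [pchar k].

Lemma nat_neq0_3smooth : [/\ 3%:R != 0 :> k, 6%:R != 0 :> k & 8%:R != 0 :> k].
Proof.
have n2 := nat2_neq0 k2; have n3 : 3%:R != 0 :> k by move: k3; rewrite inE.
split=> //; first by rewrite (_ : 6%:R = 2%:R * 3%:R :> k) ?mulf_neq0 //; ring.
by rewrite (_ : 8%:R = 2%:R ^+ 3 :> k) ?expf_neq0 //; ring.
Qed.

(** If [rho x, L_p] = L_q then pairing x with [L_p, L_b] gives a multiple of
    P q b, so that x in the radical commutes with all of Im O in the Clifford
    algebra. *)
Lemma spinor_form_nondegenerate : nondegenerate (@spinor_form k O C).
Proof.
have [n3 _ n8] := nat_neq0_3smooth.
rewrite /nondegenerate -subv0; apply/subvP => x /mem_orthovP x0.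
rewrite memv0; have [e [e' [_ esum _]]] := oim_dual_bases O k2.
suff xi p : commr (vsval x) (clifford_in C p) = 0.
  apply/eqP/val_inj/(scalerI (nat2_neq0 k2)); rewrite /= -(sum_clifford_in x esum).
  by rewrite scaler0 big1 // => i _; rewrite xi mulr0.
have [q [xq ->]] := spinor_rep_oim x p.
suff -> : q = 0 by rewrite linear0.
apply/val_inj/(oim_nondeg k2 (subvsP q)) => b bI.
have := x0 (vsproj _ (commr (clifford_in C p) (clifford_in C (vsproj _ b)))) (memvf _).
rewrite /= /spinor_form spinor_rep_commr (lftrace_spinor_rep_bracket _ xq) vsprojK //.
set X := P _ b => E.
have -> : X = 2%:R / 3%:R * (- (3%:R / 8%:R) * (- 4%:R * X)).
  by field; rewrite n8 n3.
by rewrite E mulr0.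
Qed.

Lemma lftrace_spinor_rep_lmul x a : a \in oim O ->
  lftrace (rho x \o lmul a)%VF = 0.
Proof.
move=> aI; elim/spinor_rep_ind: (rho x) => [t f g fS gS|| b c bI cI].
- by rewrite comp_lfunDl -comp_lfunZl linearP /= fS gS mulr0 addr0.
- by rewrite comp_lfun0l linear0.
exact: lftrace_lmul3.
Qed.

(** Only the rotation term of spin_op contributes: rho x is orthogonal to the
    imaginary left multiplications and to the identity. *)
Lemma lftrace_spinor_rep_op x v w :
  lftrace (rho x \o spin_op v w)%VF = - 8%:R * P (rho x v) w.
Proof.
rewrite lftrace_spin_op // lftrace_spinor_rep mulr0 addr0.
have [t [a aI ->]] := oim_decomp k2 (w ** oconj v).
rewrite linearP /= comp_lfunDr -comp_lfunZr linearP /= lftrace_spinor_rep_lmul //.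
have -> : lmul (oone : O) = \1%VF.
  by apply/lfunP => z; rewrite lmulE id_lfunE omul1x.
rewrite comp_lfun1r lftrace_spinor_rep mulr0 addr0 mulr0 subr0.
by rewrite [P v _]opolarC !polar_spinor_rep [P v _]opolarC polar_spinor_rep; ring.
Qed.

(** As rho is injective the inverse picks the only preimage of spin_op v w / 6;
    that there is one is the content of spinor_rep_moment. *)
Definition spinor_moment v w : clifford2_type C :=
  ((linfun rho)^-1)%VF (6%:R^-1 *: spin_op v w).

Lemma spinor_moment_bilinear :
  bilinear_for (GRing.Scale.Law.clone _ _ *:%R _) (GRing.Scale.Law.clone _ _ *:%R _)
    spinor_moment.
Proof.
split=> [w|v] t u u'; rewrite /spinor_moment.
  have -> : spin_op (t *: u + u') w = t *: spin_op u w + spin_op u' w.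
    exact: spin_op_linearl.
  by rewrite scalerDr scalerA [_ * t]mulrC -scalerA linearP.
have -> : spin_op v (t *: u + u') = t *: spin_op v u + spin_op v u'.
  exact: spin_op_linearr.
by rewrite scalerDr scalerA [_ * t]mulrC -scalerA linearP.
Qed.
HB.instance Definition _ :=
  bilinear_isBilinear.Build k O O (clifford2_type C) _ _ spinor_moment
    spinor_moment_bilinear.

Lemma spinor_rep_moment v w : rho (spinor_moment v w) = 6%:R^-1 *: spin_op v w.
Proof.
rewrite -[LHS](lfunE rho) limg_lfunVK //; apply: memvZ.
have rhoS x : rho x \in limg (linfun rho) by rewrite -[rho x]lfunE memv_img ?memvf.
apply: spin_op_mem => // [a b aI bI|f g].
  rewrite -[a](vsprojK aI) -[b](vsprojK bI) -spinor_rep_commr; exact: rhoS.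
case/memv_imgP=> x _ -> /memv_imgP[y _ ->]; rewrite !lfunE /=.
by rewrite -spinor_rep_lie; exact: rhoS.
Qed.

Lemma spinor_moment_map :
  moment_map (@spinor_form k O C) (@oform k O) rho spinor_moment.
Proof.
split=> [v|x v w]; first by rewrite /= /spinor_moment spin_opxx scaler0 linear0.
have n2 := nat2_neq0 k2; have [n3 n6 n8] := nat_neq0_3smooth.
rewrite /= /spinor_form spinor_rep_moment -comp_lfunZr linearZ /=.
rewrite lftrace_spinor_rep_op /oform; set X := P _ w.
by field; rewrite ?n2 ?n3 ?n6 ?n8.
Qed.

Lemma spinor_moment_special u v w :
  rho (spinor_moment u v) w + rho (spinor_moment u w) v =
  oform u v *: w + oform u w *: v - (2%:R * oform v w) *: u.
Proof.
have n2 := nat2_neq0 k2; have [n3 n6 n8] := nat_neq0_3smooth.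
rewrite !spinor_rep_moment !scale_lfunE !spin_opE.
apply: polar_inj => y; have := congr1 (polar (@onorm k O) ^~ y) (moufang_polar u v w).
rewrite /oform !omulZl !polarE (opolarC w v) => /(canRL (addrK _)) ->.
by field; rewrite ?n2 ?n6.
Qed.

Lemma spinor_orthogonal_rep : orthogonal_rep (@oform k O) rho.
Proof.
split=> [|x y|x v w].
- rewrite /nondegenerate -subv0; apply/subvP => v /mem_orthovP v0.
  rewrite memv0; apply/eqP/onorm_nondeg => w; have := v0 w (memvf w).
  move/eqP; rewrite /= /oform mulf_eq0 invr_eq0 (negPf (nat2_neq0 k2)) orbF.
  by move/eqP.
- exact: spinor_rep_lie.
by rewrite /= /oform polar_spinor_rep mulNr.
Qed.

Lemma spinor_quadratic_lie : quadratic_lie (@spinor_form k O C).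
Proof.
split; first exact: spinor_form_nondegenerate.
by move=> x y z; rewrite /= /spinor_form !spinor_rep_lie lftrace_bracket.
Qed.
End SpinorRepresentation.

Theorem theorem5p7 (k : fieldType) (O : octonionType k)
    (C : cliffordAlgebra (oim_quad O)) :
  2%N \notin [pchar k] -> 3%N \notin [pchar k] ->
  special_orthogonal (@spinor_form k O C) (@oform k O) (@spinor_rep k O C).
Proof.
move=> k2 k3; have O8 := oct_dim (s := O).
split; first exact: spinor_quadratic_lie.
  exact: spinor_orthogonal_rep.
exists (@spinor_moment k O C); first exact: spinor_moment_map.
exact: spinor_moment_special.
Qed.
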